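(* Let $n>4$ be an integer, and consider the CSS coupled wire model on the infinite lattice given by $f=y+z+yz$ and $g=n+y+z$. Then all excitations of this model are lineons moving along the wire direction $x$, i.e. every excitation can move along $x$ and no nontrivial excitation can move in the transverse $yz$ plane. Explicitly: (i) (No mobility in the $yz$ plane.) If $e\in R^2$ is an excitation and there is $(a,b)\in\mathbb{Z}^2\setminus\{(0,0)\}$ such that $(y^az^b-1)\,e\in\operatorname{im}\epsilon$, then $e\in\operatorname{im}\epsilon$, i.e. $e$ is trivial. (ii) (Mobility along the wires.) For every excitation $e\in R^2$ there is a quasi-localized real weight configuration $w$ with $\epsilon(w)=e$.
   Context: Wires extend along $x$ and are placed at the sites $(j,k)\in\mathbb{Z}^2$ of a square lattice in the $yz$ plane. Let $R=\mathbb{Z}[y,y^{-1},z,z^{-1}]$, where the monomial $y^jz^k$ stands for the site $(j,k)$, and let $p\mapsto\bar p$ be the ring involution of $R$ with $\bar y=y^{-1}$, $\bar z=z^{-1}$. Each wire carries four $2\pi$-periodic bosonic fields with $4\times4$ K matrix $K_{\mathrm w}=\sigma^x\otimes 1_{2\times 2}=\begin{pmatrix}0&1_{2}\\1_{2}&0\end{pmatrix}$. For $f,g\in R$ the CSS model has stabilizer map (its columns give the two gapping terms per site) $$\sigma=\begin{pmatrix} f&0\\ g&0\\ 0&\bar g\\ 0&-\bar f\end{pmatrix},$$ and excitation map $\epsilon=\bar\sigma^{\mathsf T}K_{\mathrm w}:R^4\to R^2$, that is $$\epsilon(l_1,l_2,l_3,l_4)=(\bar f\,l_3+\bar g\,l_4,\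 g\,l_1-f\,l_2).$$ An element $l\in R^4$ represents a local (finitely supported) vertex operator, and $\epsilon(l)$ is the configuration of integer kink strengths (excitations of the two gapping terms at each site) that it creates from the ground state. An excitation (charge) is an element $e\in R^2$; it is trivial if $e\in\operatorname{im}\epsilon$, i.e. if it can be created by a local operator. An excitation $e$ can be moved in the $yz$ plane by a displacement $(a,b)$ if some local operator creates its translate $y^az^be$ together with its inverse $-e$, i.e. if $(y^az^b-1)e\in\operatorname{im}\epsilon$. Motion along $x$ is implemented by string operators $\exp\left(i\sum_{\mathbf r} \mathbf w_{\mathbf r}^{\mathsf T}\int_{x_1}^{x_2}\partial_x\Phi_{\mathbf r}\,dx\right)$, where $\Phi_{\mathbf r}$ is the vector of four fields at site $\mathbf r$ and $\mathbf w_{\mathbf r}\in\mathbb{R}^4$. A real weight configuration is a function $w:\mathbb{Z}^2\to\mathbb{R}^4$, viewed as a 4-tuple of formal real Laurent series in $y,z$; it is quasi-localized if there are $C,c>0$ with $|w_{\mathbf r}|\le Ce^{-c|\mathbf r|}$ for all $\mathbf r\in\mathbb{Z}^2$. The map $\epsilon$ is applied to $w$ by the same formula (each product with a Laurent polynomial is a finite convolution), and $\epsilon(w)$ is, up to sign, the kink configuration created at the end points $x_1,x_2$ of the string. The excitation $e$ can be moved along $x$ if there is a quasi-localized $w$ with $\epsilon(w)=e$. *)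

(* Defs.v *)
From HB Require Import structures.
From mathcomp Require Import all_boot all_order all_algebra.
From mathcomp Require Import finmap monalg.
From mathcomp Require Import all_classical all_reals all_analysis.

Set Implicit Arguments.
Unset Strict Implicit.
Unset Printing Implicit Defensive.

Import Order.TTheory GRing.Theory Num.Theory.

Local Open Scope fset_scope.
Local Open Scope ring_scope.

(* The additive group Z^2; (j, k) is the wire at position j in y and k in z. *)
Notation site := (int * int)%type.

(* R = Z[y, y^-1, z, z^-1] as the group ring of Z^2: finitely supported
   functions site -> int under convolution, coef r p being the coefficient of
   y^j z^k in p for r = (j, k).  The product that monalg puts on {malg int[M]}
   is not available, because it requires the monoid M to have no nontrivial
   units. *)
Record laurent : Type := Laurent { laurent_val : {malg int[site]} }.

HB.instance Definition _ := [isNew for laurent_val].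
HB.instance Definition _ := [Choice of laurent by <:].

Section LaurentZmodule.
Implicit Types p q : laurent.

Definition laurent_zero := Laurent 0.
Definition laurent_opp p := Laurent (- laurent_val p).
Definition laurent_add p q := Laurent (laurent_val p + laurent_val q).

Lemma laurent_addA : associative laurent_add.
Proof. by move=> p q t; congr Laurent; apply: addrA. Qed.

Lemma laurent_addC : commutative laurent_add.
Proof. by move=> p q; congr Laurent; apply: addrC. Qed.

Lemma laurent_add0 : left_id laurent_zero laurent_add.
Proof. by case=> p; congr Laurent; apply: add0r. Qed.

Lemma laurent_addN : left_inverse laurent_zero laurent_opp laurent_add.
Proof. by move=> p; congr Laurent; apply: addNr. Qed.

End LaurentZmodule.

HB.instance Definition _ := GRing.isZmodule.Build laurent
  laurent_addA laurent_addC laurent_add0 laurent_addN.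

Definition coef (r : site) (p : laurent) : int := (laurent_val p)@_r.
Definition supp (p : laurent) : {fset site} := msupp (laurent_val p).
HB.lock Definition term (a : int) (r : site) : laurent := Laurent << a *g r >>.

HB.lock Definition laurent_mul (p q : laurent) : laurent :=
  \sum_(r <- supp p) \sum_(s <- supp q) term (coef r p * coef s q) (r + s).

(* The involution y |-> y^-1, z |-> z^-1. *)
HB.lock Definition bar (p : laurent) : laurent :=
  \sum_(r <- supp p) term (coef r p) (- r).

Section LaurentTheory.
Implicit Types (p q t : laurent) (r s : site) (a b : int).

Lemma laurentP p q : (forall r, coef r p = coef r q) <-> p = q.
Proof.
by split=> [pq|-> //]; apply: val_inj; apply/malgP.
Qed.

Lemma coef_is_zmod_morphism r : zmod_morphism (coef r).
Proof. by move=> p q; apply: (mcoeffB r (laurent_val p) (laurent_val q)). Qed.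
HB.instance Definition _ r :=
  GRing.isZmodMorphism.Build laurent int (coef r) (coef_is_zmod_morphism r).

Lemma term0 r : term 0 r = 0.
Proof. by rewrite term.unlock; congr Laurent; apply: monalgU0. Qed.

Lemma termD a b r : term (a + b) r = term a r + term b r.
Proof. by rewrite term.unlock; congr Laurent; apply: monalgUD. Qed.

Lemma coef_term a r s : coef s (term a r) = a *+ (r == s).
Proof. by rewrite term.unlock; apply: mcoeffU. Qed.

Lemma coef_outdom p r : r \notin supp p -> coef r p = 0.
Proof. exact: mcoeff_outdom. Qed.

Lemma supp_term a r : supp (term a r) `<=` [fset r].
Proof. by rewrite term.unlock; apply: msuppU_le. Qed.

Lemma suppD_le p q : supp (p + q) `<=` supp p `|` supp q.
Proof. exact: (msuppD_le (laurent_val p) (laurent_val q)). Qed.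

Lemma laurentE p : p = \sum_(r <- supp p) term (coef r p) r.
Proof.
apply: val_inj; rewrite term.unlock (big_morph val (id1 := 0) (op1 := +%R)) //.
exact: monalgE.
Qed.

Lemma laurent_ind (P : laurent -> Prop) :
  P 0 -> (forall p q, P p -> P q -> P (p + q)) -> (forall a r, P (term a r)) ->
  forall p, P p.
Proof. by move=> P0 PD PU p; rewrite [p]laurentE; apply: big_ind. Qed.

Lemma laurent_mulw (d1 d2 : {fset site}) p q :
  supp p `<=` d1 -> supp q `<=` d2 ->
  laurent_mul p q =
    \sum_(r <- d1) \sum_(s <- d2) term (coef r p * coef s q) (r + s).
Proof.
move=> le_d1 le_d2; rewrite laurent_mul.unlock (big_fset_incl _ le_d1) /=.
  apply/eq_bigr=> r _; apply/big_fset_incl => // s _ /coef_outdom ->.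
  by rewrite mulr0 term0.
move=> r _ /coef_outdom pr.
by rewrite big1 => // s _; rewrite pr mul0r term0.
Qed.

Lemma laurent_mulC : commutative laurent_mul.
Proof.
move=> p q; rewrite laurent_mul.unlock exchange_big /=.
by apply/eq_bigr=> s _; apply/eq_bigr=> r _; rewrite mulrC addrC.
Qed.

Lemma laurent_mul_term a b r s :
  laurent_mul (term a r) (term b s) = term (a * b) (r + s).
Proof.
rewrite (@laurent_mulw [fset r] [fset s]) ?supp_term //.
by rewrite !big_seq_fset1 !coef_term !eqxx.
Qed.

Lemma laurent_mulDl : left_distributive laurent_mul +%R.
Proof.
move=> p1 p2 q.
rewrite (laurent_mulw (fsubsetUl (supp p1) (supp p2)) (fsubset_refl _)).
rewrite (laurent_mulw (fsubsetUr (supp p1) (supp p2)) (fsubset_refl _)).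
rewrite (laurent_mulw (suppD_le p1 p2) (fsubset_refl _)).
rewrite -big_split /=; apply/eq_bigr=> r _.
rewrite -big_split /=; apply/eq_bigr=> s _.
by rewrite raddfD mulrDl termD.
Qed.

Lemma laurent_mulDr : right_distributive laurent_mul +%R.
Proof. by move=> p q1 q2; rewrite !(laurent_mulC p) laurent_mulDl. Qed.

Lemma laurent_mul0 : left_zero 0 laurent_mul.
Proof. by move=> p; apply: (addIr (laurent_mul 0 p)); rewrite -laurent_mulDl !add0r. Qed.

Lemma laurent_mulA : associative laurent_mul.
Proof.
have mul0 p : laurent_mul p 0 = 0 by rewrite laurent_mulC laurent_mul0.
move=> p q t; elim/laurent_ind: p => [|p1 p2 IH1 IH2|a r].
- by rewrite !laurent_mul0.
- by rewrite !laurent_mulDl IH1 IH2.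
elim/laurent_ind: q => [|q1 q2 IH1 IH2|b s].
- by rewrite mul0 !laurent_mul0 mul0.
- by rewrite laurent_mulDr !laurent_mulDl laurent_mulDr IH1 IH2.
elim/laurent_ind: t => [|t1 t2 IH1 IH2|c u].
- by rewrite !mul0.
- by rewrite !laurent_mulDr IH1 IH2.
by rewrite !laurent_mul_term mulrA addrA.
Qed.

Lemma laurent_mul1 : left_id (term 1 0) laurent_mul.
Proof.
move=> p; elim/laurent_ind: p => [|p q IHp IHq|a r].
- by rewrite laurent_mulC laurent_mul0.
- by rewrite laurent_mulDr IHp IHq.
by rewrite laurent_mul_term mul1r add0r.
Qed.

Lemma laurent_one_neq0 : term 1 0 != 0.
Proof. by apply/eqP=> /(congr1 (coef 0)); rewrite coef_term raddf0. Qed.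

End LaurentTheory.

HB.instance Definition _ := GRing.Zmodule_isComNzRing.Build laurent
  laurent_mulA laurent_mulC laurent_mul1 laurent_mulDl laurent_one_neq0.

Definition mono (r : site) : laurent := term 1 r.

Section LaurentRingTheory.
Implicit Types (p q : laurent) (r s : site) (a b : int).

Lemma termM a b r s : term a r * term b s = term (a * b) (r + s).
Proof. exact: laurent_mul_term. Qed.

Lemma monoD r s : mono (r + s) = mono r * mono s.
Proof. by rewrite termM mulr1. Qed.

Lemma coefM p q r :
  coef r (p * q) = \sum_(s <- supp p) coef s p * coef (r - s) q.
Proof.
rewrite {1}[p]laurentE mulr_suml raddf_sum; apply: eq_bigr => s _.
elim/laurent_ind: q => [|q1 q2 IH1 IH2|b u].
- by rewrite mulr0 !raddf0 mulr0.
- by rewrite mulrDr !raddfD /= IH1 IH2 mulrDr.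
rewrite termM /= !coef_term mulrnAr; congr (_ *+ _).
by rewrite eq_sym addrC -subr_eq eq_sym.
Qed.

Lemma coef_bar p r : coef r (bar p) = coef (- r) p.
Proof.
rewrite [in RHS](laurentE p) bar.unlock !raddf_sum /=.
by apply/eq_bigr=> s _; rewrite !coef_term eqr_oppLR.
Qed.

Lemma bar_term a r : bar (term a r) = term a (- r).
Proof. by apply/laurentP=> s; rewrite coef_bar !coef_term eqr_oppLR. Qed.

Lemma bar_is_zmod_morphism : zmod_morphism bar.
Proof. by move=> p q; apply/laurentP=> r; rewrite coef_bar !raddfB /= !coef_bar. Qed.
HB.instance Definition _ :=
  GRing.isZmodMorphism.Build laurent laurent bar bar_is_zmod_morphism.

Lemma bar_is_monoid_morphism : monoid_morphism bar.
Proof.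
split=> [|p q]; first by rewrite bar_term oppr0.
elim/laurent_ind: p => [|p1 p2 IH1 IH2|a r].
- by rewrite mul0r !raddf0 mul0r.
- by rewrite mulrDl !(raddfD bar) mulrDl /= IH1 IH2.
elim/laurent_ind: q => [|q1 q2 IH1 IH2|b s].
- by rewrite mulr0 !raddf0 mulr0.
- by rewrite mulrDr !(raddfD bar) mulrDr /= IH1 IH2.
by rewrite termM !bar_term termM opprD.
Qed.
HB.instance Definition _ :=
  GRing.isMonoidMorphism.Build laurent laurent bar bar_is_monoid_morphism.

Lemma barK : involutive bar.
Proof. by move=> p; apply/laurentP=> r; rewrite !coef_bar opprK. Qed.

End LaurentRingTheory.

Section CSS.
Variables f g : laurent.

Definition sigma : 'M[laurent]_(4, 2) :=
  \matrix_(i < 4, j < 2)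
    (nth [::] [:: [:: f; 0       ];
                  [:: g; 0       ];
                  [:: 0; bar g   ];
                  [:: 0; - bar f ]] i)`_j.

Definition Kw : 'M[laurent]_4 := @block_mx _ 2 2 2 2 0 1%:M 1%:M 0.

Definition eps : 'M[laurent]_(2, 4) := (map_mx bar sigma)^T *m Kw.

Definition trivial_exc (e : 'cV[laurent]_2) : Prop :=
  exists l : 'cV[laurent]_4, eps *m l = e.

Definition movable_yz (r : site) (e : 'cV[laurent]_2) : Prop :=
  trivial_exc ((mono r - 1) *: e).

Section Real.
Variable K : realType.

(* The product of a Laurent polynomial with a formal real Laurent series. *)
Definition conv (p : laurent) (u : site -> K) (r : site) : K :=
  \sum_(s <- supp p) (coef s p)%:~R * u (r - s).

Definition eps_real (w : site -> 'cV[K]_4) (r : site) : 'cV[K]_2 :=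
  \col_i \sum_j conv (eps i j) (fun s => w s j 0) r.

(* Euclidean norms; the library's norm on matrices is the max norm. *)
Definition vec_norm n (v : 'cV[K]_n) : K := Num.sqrt (\sum_i v i 0 ^+ 2).
Definition site_norm (r : site) : K := Num.sqrt ((r.1 ^+ 2 + r.2 ^+ 2)%:~R).

Definition quasi_localized (w : site -> 'cV[K]_4) : Prop :=
  exists C c : K, [/\ 0 < C, 0 < c &
    forall r, vec_norm (w r) <= C * expR (- (c * site_norm r))].

Definition movable_x (e : 'cV[laurent]_2) : Prop :=
  exists w : site -> 'cV[K]_4, quasi_localized w /\
    forall r i, eps_real w r i 0 = (coef r (e i 0))%:~R.

End Real.
End CSS.

Lemma KwE (i j : 'I_4) : Kw i j = (i == (j + 2) %% 4 :> nat)%N%:R.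
Proof.
rewrite mxE; case: splitP => u iu; rewrite mxE; case: splitP => v jv; rewrite mxE iu jv;
  by case: u {iu} => [[|[|u]] //= ?]; case: v {jv} => [[|[|v]] //= ?].
Qed.

Lemma eps_mxE f g : eps f g = \matrix_(i < 2, j < 4)
  (nth [::] [:: [:: 0; 0  ; bar f; bar g];
                [:: g; - f; 0    ; 0    ]] i)`_j.
Proof.
apply/matrixP=> i j; rewrite !mxE !big_ord_recl big_ord0 !KwE !mxE.
case: i => [[|[|i]] //= Hi]; case: j => [[|[|[|[|j]]]] //= Hj];
  by rewrite /bump /= ?(mulr0, mulr1, add0r, addr0, rmorph0, rmorphN) /= ?barK.
Qed.

(* eps (l1, l2, l3, l4) = (bar f l3 + bar g l4, g l1 - f l2) *)
Lemma epsE f g (l : 'cV[laurent]_4) : eps f g *m l =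
  \col_(i < 2) [:: bar f * l 2 0 + bar g * l 3 0; g * l 0 0 - f * l 1 0]`_i.
Proof.
have l_nat k (i j : 'I_4) : i = j :> nat -> l i k = l j k by move=> /val_inj->.
apply/matrixP=> i j; rewrite eps_mxE ord1 !mxE !big_ord_recl big_ord0 !mxE /=.
case: i => [[|[|i]] //= Hi]; rewrite !(mul0r, add0r, addr0, mulNr).
  by congr (_ * _ + _ * _); apply: l_nat.
by congr (_ * _ - _ * _); apply: l_nat.
Qed.

(* Main.v *)
From mathcomp Require Import all_boot all_order all_algebra.
From mathcomp Require Import finmap.
From mathcomp Require Import all_classical all_reals all_analysis.
From mathcomp Require Import ring lra zify.
Require Import Defs.

(* (i) An excitation splits into two elements of R / (f, g), up to the bar on
   the first one.  Since f - g = y z - n and (1 + y) g - f = y^2 + n y + n, the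
   quotient R / (f, g) is Z[1/n][x] with x a root of X^2 + n X + n, y = x and z
   the conjugate root t.  For n > 4 the discriminant n^2 - 4 n is positive and
   not a square, so this is a subring of the reals.  It remains to see that
   x^a t^b = 1 forces a = b = 0: multiplying by the conjugate relation gives
   n^(a+b) = 1, so b = - a, and then (x / t)^a = 1 with x / t positive and
   different from 1.
   (ii) 1 / g is a geometric series in (y + z) / n with exponentially decaying
   coefficients, so e is created by the weights e_2 / g and e_1 / bar g. *)

Set Implicit Arguments.
Unset Strict Implicit.
Unset Printing Implicit Defensive.

Import Order.TTheory GRing.Theory Num.Theory.
Local Open Scope ring_scope.

(** Rewrites the scalar [n] occurring in [g] as a monomial, so that the formulas for [term] apply to
    it. *)
Lemma intr_term (a : int) : a%:~R = term a 0 :> laurent.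
Proof.
have nat_term (m : nat) : (m%:R : laurent) = term m%:Z 0.
  elim: m => [|m IH]; first by rewrite term0.
  by rewrite -addn1 PoszD termD natrD IH.
by case: a => m; rewrite ?NegzE ?mulrNz -pmulrn nat_term //; apply/laurentP => s;
  rewrite raddfN /= !coef_term mulNrn.
Qed.

Lemma intr_neq0_of_gt4 (K : realType) (n : int) : 4 < n -> n%:~R != 0 :> K.
Proof. by rewrite intr_eq0; lia. Qed.

(** * Action of Laurent polynomials on real series, and exponential decay *)

Section Convolution.
Variable K : realType.
Implicit Types (p q : laurent) (u v : site -> K) (r s : site).

Lemma conv_fset (d : {fset site}) p u r : (supp p `<=` d)%fset ->
  conv p u r = \sum_(s <- d) (coef s p)%:~R * u (r - s).
Proof.
move=> pd; rewrite /conv (big_fset_incl _ pd) // => s _ /coef_outdom ->.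
by rewrite mul0r.
Qed.

Lemma convDl p q u r : conv (p + q) u r = conv p u r + conv q u r.
Proof.
rewrite (conv_fset _ _ (suppD_le p q)).
rewrite (conv_fset _ _ (fsubsetUl (supp p) (supp q))).
rewrite (conv_fset _ _ (fsubsetUr (supp p) (supp q))).
rewrite -big_split /=; apply: eq_bigr => s _.
by rewrite raddfD /= intrD mulrDl.
Qed.

Lemma conv_term a s u r : conv (term a s) u r = a%:~R * u (r - s).
Proof. by rewrite (conv_fset _ _ (supp_term a s)) big_seq_fset1 coef_term eqxx. Qed.

Lemma conv0l u r : conv 0 u r = 0.
Proof. by rewrite -(term0 0) conv_term mul0r. Qed.

Lemma eq_conv p u v : u =1 v -> conv p u =1 conv p v.
Proof. by move=> uv r; apply: eq_bigr => s _; rewrite uv. Qed.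

Lemma conv0r p r : conv p (fun=> 0 : K) r = 0.
Proof. by rewrite /conv big1 // => s _; rewrite mulr0. Qed.

(** Real series form a module over the Laurent polynomials, so multiplication by [g] can be commuted
    past any other factor before it meets the inverse series. *)
Lemma convM p q u r : conv (p * q) u r = conv p (conv q u) r.
Proof.
elim/laurent_ind: p r => [|p1 p2 IH1 IH2|a s] r.
- by rewrite mul0r !conv0l.
- by rewrite mulrDl !convDl IH1 IH2.
rewrite conv_term; elim/laurent_ind: q => [|q1 q2 IH1 IH2|b t].
- by rewrite mulr0 !conv0l mulr0.
- by rewrite mulrDr !convDl IH1 IH2 mulrDr.
by rewrite termM !conv_term intrM mulrA opprD addrA.
Qed.

Lemma conv_delta p r : conv p (fun s => (s == 0)%:R : K) r = (coef r p)%:~R.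
Proof.
elim/laurent_ind: p => [|p1 p2 IH1 IH2|a s].
- by rewrite conv0l raddf0.
- by rewrite convDl IH1 IH2 raddfD /= intrD.
by rewrite conv_term coef_term subr_eq0 eq_sym; case: eqP; rewrite ?mulr1 ?mulr0.
Qed.

Definition l1norm r : nat := (`|r.1| + `|r.2|)%N.

(** The $\ell^1$ norm keeps the exponent a natural number; the passage to the Euclidean norm and
    [expR] is made only in [decays_quasi_localized]. *)
Definition decays u := exists2 C : K, 0 <= C & forall r, `|u r| <= C * 2^-1 ^+ l1norm r.

Lemma decays0 : decays (fun=> 0).
Proof. by exists 0 => // r; rewrite normr0 mul0r. Qed.

Lemma decaysD u v : decays u -> decays v -> decays (fun r => u r + v r).
Proof.
move=> [C C0 uC] [D D0 vD]; exists (C + D); first exact: addr_ge0.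
by move=> r; rewrite mulrDl (le_trans (ler_normD _ _)) ?lerD.
Qed.

(** By the triangle inequality for [l1norm], a shift by [s] costs at most a factor [2 ^+ l1norm s],
    and only finitely many shifts occur. *)
Lemma decays_conv p u : decays u -> decays (conv p u).
Proof.
move=> du; elim/laurent_ind: p => [|p1 p2 IH1 IH2|a s].
- by case: (decays0) => C C0 H; exists C => // r; rewrite conv0l.
- by case: (decaysD IH1 IH2) => C C0 H; exists C => // r; rewrite convDl.
have [C C0 uC] := du.
exists (`|a%:~R| * C * 2 ^+ l1norm s); first by rewrite !mulr_ge0 ?exprn_ge0.
move=> r; rewrite conv_term normrM -!mulrA ler_wpM2l //.
apply: (le_trans (uC _)); rewrite ler_wpM2l //.
have le_rs : (l1norm r <= l1norm s + l1norm (r - s)%R)%N by rewrite /l1norm /=; lia.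
rewrite -ler_pdivrMl ?exprn_gt0 // -exprVn -exprD.
by apply: ler_wiXn2l => //; lra.
Qed.

End Convolution.

(** * The inverse series of [g] and its decay *)

Lemma leq_bin_exp2 m i : ('C(m, i) <= 2 ^ m)%N.
Proof.
elim: m i => [|m IH] [|i]; rewrite ?bin0 ?bin0n ?expn_gt0 //.
by rewrite binS expnS mul2n -addnn leq_add.
Qed.

Section InverseSeries.
Variables (K : realType) (n : int).
Hypothesis n_gt4 : 4 < n.
Implicit Type r : site.

(* 1 / (n + y + z) = sum_m (-1)^m (y + z)^m / n^(m + 1). *)
Definition ginv r : K :=
  if r is (Posz j, Posz k)
  then (-1) ^+ (j + k) * 'C(j + k, j)%:R / n%:~R ^+ (j + k).+1 else 0.

Let y := mono (1, 0).
Let z := mono (0, 1).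
Let g := n%:~R + y + z.

(** Away from the origin the three contributions cancel by Pascal's rule. On an axis one neighbour
    falls outside the quadrant, where [ginv] vanishes, and the binomials left are 1. *)
Lemma conv_ginv r : conv g ginv r = (r == 0)%:R.
Proof.
rewrite !convDl intr_term !conv_term !mul1r subr0.
have n0 := intr_neq0_of_gt4 K n_gt4.
have predS (m : nat) : (m.+1 : int) - 1 = m by lia.
have predN (m : nat) : Negz m - 1 = Negz m.+1 by rewrite !NegzE; lia.
case: r => j k.
have -> : (j, k) - (1, 0) = (j - 1, k) by congr (_, _); rewrite ?subr0.
have -> : (j, k) - (0, 1) = (j, k - 1) by congr (_, _); rewrite ?subr0.
case: j => [[|j]|j]; case: k => [[|k]|k]; rewrite ?predS ?predN ?sub0r /=.
- by rewrite bin0 !addr0 mul1r expr1; field; rewrite ?n0.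
- rewrite !add0n !bin0 !mulr1 addr0 !exprS; field; rewrite ?n0 ?expf_neq0 //.
- by rewrite mulr0 !addr0.
- rewrite !addn0 !binn !mulr1 addr0 !exprS; field; rewrite ?n0 ?expf_neq0 //.
- rewrite !addSn !addnS binS natrD !exprS; field; rewrite ?n0 ?expf_neq0 //.
- by rewrite mulr0 !addr0.
- by rewrite mulr0 !addr0.
- by rewrite mulr0 !addr0.
- by rewrite mulr0 !addr0.
Qed.

(** With $m=j+k$ the coefficient is at most $2^m/n^{m+1}$ in absolute value, and $4^m\le n^m$ turns
    this into $2^{-m}$. *)
Lemma decays_ginv : decays ginv.
Proof.
exists 1 => // -[[j|j] [k|k]] /=; rewrite ?normr0 ?mulr_ge0 ?exprn_ge0 ?invr_ge0 //.
rewrite mul1r /l1norm /= normrM normrV ?unitfE ?expf_neq0 ?(intr_neq0_of_gt4 K n_gt4) //.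
rewrite normrM normrX normrN1 expr1n mul1r normrX !normr_nat.
have n4 : 4 <= n%:~R :> K by move: (ltW n_gt4); rewrite -(ler_int K) rmorph_nat.
have n0 : 0 < n%:~R :> K by lra.
rewrite (ger0_norm (ltW n0)) ler_pdivrMr ?exprn_gt0 //.
have bin_le := leq_bin_exp2 (j + k) j.
rewrite (le_trans (_ : _ <= (2 ^ (j + k))%:R)) ?ler_nat // natrX.
rewrite exprVn ler_pdivlMl ?exprn_gt0 // -exprD.
rewrite addnn exprS -muln2 mulnC exprM.
have -> : 2 ^+ 2 = 4 :> K by ring.
apply: (@le_trans _ _ (n%:~R ^+ (j + k))).
  by rewrite lerXn2r // ?nnegrE // ltW.
by rewrite ler_peMl ?exprn_ge0 // ?ltW //; lra.
Qed.

End InverseSeries.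

(** * Quasi-localized weights and motion along the wires *)

Section Mobility.
Variable K : realType.
Implicit Types (p q : laurent) (u v : site -> K) (r s : site).

Lemma conv_bar p u r : conv (bar p) (fun s => u (- s)) r = conv p u (- r).
Proof.
elim/laurent_ind: p => [|p1 p2 IH1 IH2|a s].
- by rewrite raddf0 !conv0l.
- by rewrite raddfD !convDl IH1 IH2.
by rewrite bar_term !conv_term opprK opprD.
Qed.

Lemma decays_opp u : decays u -> decays (fun s => u (- s)).
Proof.
move=> [C C0 uC]; exists C => // r; apply: (le_trans (uC _)).
by rewrite /l1norm /= !abszN.
Qed.

Lemma decays_sum (I : Type) (t : seq I) (F : I -> site -> K) :
  (forall i, decays (F i)) -> decays (fun r => \sum_(i <- t) F i r).
Proof.
move=> dF; elim: t => [|i t IH].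
  by case: (decays0 K) => C C0 H; exists C => // r; rewrite big_nil.
by case: (decaysD (dF i) IH) => C C0 H; exists C => // r; rewrite big_cons.
Qed.

Lemma vec_norm_le m (v : 'cV[K]_m) : vec_norm v <= \sum_i `|v i 0|.
Proof.
have S0 : 0 <= \sum_i `|v i 0| by apply: sumr_ge0.
rewrite -[leRHS](ger0_norm S0) -sqrtr_sqr ler_wsqrtr // expr2 mulr_suml.
apply: ler_sum => i _; rewrite -(real_normK (num_real (v i 0))) expr2 ler_wpM2l //.
by rewrite (bigD1 i) //= lerDl sumr_ge0.
Qed.

Lemma site_norm_le r : site_norm K r <= (l1norm r)%:R.
Proof.
rewrite -[leRHS]ger0_norm // -sqrtr_sqr ler_wsqrtr //.
have -> : (l1norm r)%:R ^+ 2 = ((l1norm r : int) ^+ 2)%:~R :> K by rewrite rmorphXn.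
by rewrite ler_int /l1norm PoszD !abszE; nia.
Qed.

Lemma decays_quasi_localized (w : site -> 'cV[K]_4) :
  (forall i, decays (fun r => w r i 0)) -> quasi_localized w.
Proof.
move=> dw; have [|C C0 wC] := @decays_sum _ (index_enum 'I_4) (fun i r => `|w r i 0|).
  by move=> i; have [C C0 H] := dw i; exists C => // r; rewrite normr_id.
have ln2 : 0 < ln 2 :> K by rewrite ln_gt0 // ltr1n.
(* [decays] allows [C = 0], while [quasi_localized] needs a positive constant; the rate is [ln 2]
   because $2^{-1}=e^{-\ln 2}$. *)
exists (C + 1), (ln 2); split => // [|r]; first by rewrite ltr_wpDl.
apply: (le_trans (vec_norm_le _)); apply: (le_trans (ler_norm _)).
apply: (le_trans (wC r)); apply: ler_pM; rewrite ?exprn_ge0 ?lerDl //.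
have -> : 2^-1 = expR (- ln 2) :> K by rewrite expRN lnK // posrE.
by rewrite -expRM_natr ler_expR mulNr lerN2 ler_wpM2l ?site_norm_le // ltW.
Qed.

Lemma movable_x_of_inverse (f g : laurent) (h : site -> K) :
  decays h -> conv g h =1 (fun r => (r == 0)%:R) ->
  forall e, movable_x f g K e.
Proof.
(* Reflecting [h] gives an inverse series for [bar g]. *)
move=> dh gh e; pose h' s := h (- s).
have ghE p : conv g (conv p h) =1 fun r => (coef r p)%:~R.
  by move=> r; rewrite -convM mulrC convM (eq_conv _ gh) conv_delta.
have gh'E p : conv (bar g) (conv p h') =1 fun r => (coef r p)%:~R.
  have gh' : conv (bar g) h' =1 (fun r => (r == 0)%:R).
    by move=> r; rewrite conv_bar gh oppr_eq0.
  by move=> r; rewrite -convM mulrC convM (eq_conv _ gh') conv_delta.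
(* Only the entries that [eps] multiplies by [g] and by [bar g] are used: they solve the second and
   the first component respectively. *)
exists (fun r => \col_i [:: conv (e 1 0) h r; 0; 0; conv (e 0 0) h' r]`_i).
split.
  apply: decays_quasi_localized => -[i Hi].
  suff [C C0 H] : decays (fun r => [:: conv (e 1 0) h r; 0; 0; conv (e 0 0) h' r]`_i).
    by exists C => // r; rewrite mxE.
  case: i Hi => [|[|[|[|//]]]] _ /=.
  - exact: decays_conv.
  - exact: decays0.
  - exact: decays0.
  - exact/decays_conv/decays_opp.
move=> r i; rewrite mxE eps_mxE !big_ord_recl big_ord0 !mxE /=.
have E (j : 'I_4) p t : conv p (fun s => (\col_i [:: conv (e 1 0) h s; 0; 0;
    conv (e 0 0) h' s]`_i) j 0) t =
  conv p (fun s => [:: conv (e 1 0) h s; 0; 0; conv (e 0 0) h' s]`_j) t.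
  by apply: eq_conv => s; rewrite mxE.
rewrite !E /= !conv0r.
case: i => [[|[|//]] Hi] /=; rewrite !conv0l !(add0r, addr0).
  by rewrite gh'E; congr (coef _ (e _ _))%:~R; apply: val_inj.
by rewrite ghE; congr (coef _ (e _ _))%:~R; apply: val_inj.
Qed.

End Mobility.

(** * Reduction modulo the ideal of [f] and [g] *)

Section Ideal.
Variable n : int.
Implicit Types (p q : laurent) (r s : site).

Let y := mono (1, 0).
Let z := mono (0, 1).
Let y' := mono (-1, 0).
Let z' := mono (0, -1).
Let f := y + z + y * z.
Let g := n%:~R + y + z.

Definition ideal2 f g p := exists u v, p = u * f + v * g.

Lemma mono_yV : y' * y = 1.
Proof. by rewrite -monoD. Qed.

Lemma mono_zV : z' * z = 1.
Proof. by rewrite -monoD. Qed.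

(* [n] is a unit modulo the ideal, being congruent to [y * z]. *)
Lemma ideal2_n_cancel N p : ideal2 f g (n%:~R ^+ N * p) -> ideal2 f g p.
Proof.
elim: N => [|N IH]; first by rewrite mul1r.
rewrite exprS -mulrA => -[u [v E]]; apply: IH; set q := _ * p in E *.
(* Since [f - g = y * z - n], one has [y * z * q = n * q + q * f - q * g]; dividing by [y * z]
   yields these coefficients. *)
exists (y' * z' * (q + u)), (y' * z' * (v - q)).
transitivity (y' * z' * (n%:~R * q + q * f - q * g)); last by rewrite E; ring.
transitivity (y' * y * (z' * z) * q); first by rewrite mono_yV mono_zV !mul1r.
by rewrite /f /g; ring.
Qed.

(** Once [n] is inverted, the quotient is spanned by [1] and [y]; the factor [n ^+ N] clears the
    denominators. *)
Definition reducible p := exists (N : nat) (a b : int),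
  ideal2 f g (n%:~R ^+ N * p - (a%:~R + b%:~R * y)).

Lemma reducible_ideal p : ideal2 f g p -> reducible p.
Proof.
by move=> [u [v ->]]; exists 0%N, 0, 0, u, v; rewrite mulr0z; ring.
Qed.

Lemma reducibleD p q : reducible p -> reducible q -> reducible (p + q).
Proof.
move=> [N [a [b [u [v E]]]]] [M [c [d [u1 [v1 E1]]]]].
exists (N + M)%N, (n ^+ M * a + n ^+ N * c), (n ^+ M * b + n ^+ N * d).
exists (n%:~R ^+ M * u + n%:~R ^+ N * u1), (n%:~R ^+ M * v + n%:~R ^+ N * v1).
transitivity (n%:~R ^+ M * (u * f + v * g) + n%:~R ^+ N * (u1 * f + v1 * g)).
  rewrite -E -E1 !(intrD, intrM) -!rmorphXn exprD /=; ring.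
ring.
Qed.

Lemma reducibleZ c p : reducible p -> reducible (c%:~R * p).
Proof.
move=> [N [a [b [u [v E]]]]]; exists N, (c * a), (c * b), (c%:~R * u), (c%:~R * v).
transitivity (c%:~R * (u * f + v * g)); last by ring.
by rewrite -E !intrM; ring.
Qed.

Lemma reducible_n p : reducible (n%:~R * p) -> reducible p.
Proof. by move=> [N H]; exists N.+1; rewrite exprSr -mulrA. Qed.

Lemma reducible_y p : reducible p -> reducible (y * p).
Proof.
move=> [N [a [b [u [v E]]]]]; exists N, (- n * b), (a - n * b).
(* These come from replacing [y ^+ 2] by [- n * y - n], with correction [(1 + y) * g - f]. *)
exists (y * u - b%:~R), (y * v + b%:~R * (1 + y)).
transitivity (y * (u * f + v * g) - b%:~R * f + b%:~R * (1 + y) * g); last by ring.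
by rewrite -E /f /g !(intrD, intrM, mulrNz); ring.
Qed.

Lemma reducible_z p : reducible p -> reducible (z * p).
Proof.
move=> rp; have -> : z * p = p * g + (- n)%:~R * p + (-1)%:~R * (y * p).
  by rewrite /g !mulrNz; ring.
apply: reducibleD; last exact/reducibleZ/reducible_y.
apply: reducibleD; last exact: reducibleZ.
by apply: reducible_ideal; exists 0, p; ring.
Qed.

(* Modulo [f - g = y z - n], dividing by [y] is multiplying by [z / n]. *)
Lemma reducible_yV p : reducible p -> reducible (y' * p).
Proof.
move=> rp; apply: reducible_n.
have -> : n%:~R * (y' * p) = z * p + (- (y' * p) * f + y' * p * g).
  rewrite [X in X + _](_ : z * p = y' * y * (z * p)); last by rewrite mono_yV mul1r.
  by rewrite /f /g; ring.
by apply: reducibleD; [exact: reducible_z | apply: reducible_ideal; eexists; eexists].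
Qed.

Lemma reducible_zV p : reducible p -> reducible (z' * p).
Proof.
move=> rp; apply: reducible_n.
have -> : n%:~R * (z' * p) = y * p + (- (z' * p) * f + z' * p * g).
  rewrite [X in X + _](_ : y * p = z' * z * (y * p)); last by rewrite mono_zV mul1r.
  by rewrite /f /g; ring.
by apply: reducibleD; [exact: reducible_y | apply: reducible_ideal; eexists; eexists].
Qed.

(** Every monomial is reached from [1] by multiplications by [y], [z] and their inverses, all of
    which preserve reducibility. *)
Lemma reducible_all p : reducible p.
Proof.
elim/laurent_ind: p => [|p q IHp IHq|a [j k]].
- by apply: reducible_ideal; exists 0, 0; ring.
- exact: reducibleD.
have -> : term a (j, k) = a%:~R * mono (j, k) by rewrite intr_term /mono termM mulr1 add0r.
apply: reducibleZ; elim: j => [|j IH|j IH].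
- elim: k => [|k IH|k IH].
  + by exists 0%N, 1, 0, 0, 0; rewrite -[mono _]/(1 : laurent); ring.
  + have -> : mono (0, k.+1 : int) = z * mono (0, k : int).
      by rewrite -monoD; congr mono; congr (_, _); rewrite -intS.
    exact: reducible_z.
  + have -> : mono (0, - (k.+1 : int)) = z' * mono (0, - (k : int)).
      by rewrite -monoD; congr mono; congr (_, _); rewrite intS opprD.
    exact: reducible_zV.
- have -> : mono (j.+1 : int, k) = y * mono (j : int, k).
    by rewrite -monoD; congr mono; congr (_, _); rewrite -?intS ?add0r.
  exact: reducible_y.
- have -> : mono (- (j.+1 : int), k) = y' * mono (- (j : int), k).
    by rewrite -monoD; congr mono; congr (_, _); rewrite ?intS ?opprD ?add0r.
  exact: reducible_yV.
Qed.

End Ideal.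

(** * Evaluation at the two real roots *)

Section Evaluation.
Variable K : realType.
Implicit Types (p q : laurent) (r s : site) (x t : K).

(* The sign in the exponents undoes the reflection in [conv p u 0 = \sum_s p_s u(- s)]. *)
Definition laurent_eval x t p : K :=
  conv p (fun s => x ^ (- s.1) * t ^ (- s.2)) 0.

Lemma laurent_evalD x t p q :
  laurent_eval x t (p + q) = laurent_eval x t p + laurent_eval x t q.
Proof. exact: convDl. Qed.

Lemma laurent_eval_term x t a r :
  laurent_eval x t (term a r) = a%:~R * (x ^ r.1 * t ^ r.2).
Proof. by rewrite /laurent_eval conv_term sub0r /= !opprK. Qed.

Lemma laurent_eval0 x t : laurent_eval x t 0 = 0.
Proof. exact: conv0l. Qed.

Lemma laurent_evalM x t p q : x != 0 -> t != 0 ->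
  laurent_eval x t (p * q) = laurent_eval x t p * laurent_eval x t q.
Proof.
move=> x0 t0; elim/laurent_ind: p => [|p1 p2 IH1 IH2|a r].
- by rewrite mul0r !laurent_eval0 mul0r.
- by rewrite mulrDl !laurent_evalD IH1 IH2 mulrDl.
elim/laurent_ind: q => [|q1 q2 IH1 IH2|b s].
- by rewrite mulr0 !laurent_eval0 mulr0.
- by rewrite mulrDr !laurent_evalD IH1 IH2 mulrDr.
rewrite termM !laurent_eval_term /= !expfzDr // intrM; ring.
Qed.

Lemma laurent_evalB x t p q :
  laurent_eval x t (p - q) = laurent_eval x t p - laurent_eval x t q.
Proof. by apply/eqP; rewrite eq_sym subr_eq -laurent_evalD subrK. Qed.

Lemma laurent_eval_mono x t r : laurent_eval x t (mono r) = x ^ r.1 * t ^ r.2.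
Proof. by rewrite laurent_eval_term mul1r. Qed.

Lemma laurent_eval_int x t a : laurent_eval x t a%:~R = a%:~R.
Proof. by rewrite intr_term laurent_eval_term /= !mulr1. Qed.

Lemma ideal2_eval (f g : laurent) x t p : x != 0 -> t != 0 ->
  laurent_eval x t f = 0 -> laurent_eval x t g = 0 -> ideal2 f g p ->
  laurent_eval x t p = 0.
Proof.
move=> x0 t0 f0 g0 [u [v ->]].
by rewrite laurent_evalD !laurent_evalM // f0 g0 !mulr0 addr0.
Qed.

Section Roots.
Variable n : int.
Hypothesis n_gt4 : 4 < n.

Let f := mono (1, 0) + mono (0, 1) + mono (1, 0) * mono (0, 1).
Let g := n%:~R + mono (1, 0) + mono (0, 1).

(** If [b] were nonzero, [- a / b] would be a rational root of $X^2+nX+n$, making the discriminant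
    $n^2-4n$ a perfect square. For $n>4$ it lies strictly between $(n-3)^2$ and $(n-2)^2$. *)
Lemma no_rational_root (a b : int) : a ^+ 2 - n * a * b + n * b ^+ 2 = 0 -> b = 0.
Proof.
move=> E; apply/eqP; apply: contraT => b0.
have E2 : (2 * a - n * b) ^+ 2 = (n ^+ 2 - 4 * n) * b ^+ 2.
  by apply/eqP; rewrite -subr_eq0 -(mulr0 4) -E; apply/eqP; ring.
(* Divisibility of squares descends to their bases, so the square root of the discriminant is an
   integer [c]. *)
have /dvdzP[c Ec] : (b %| (2 * a - n * b))%Z.
  by rewrite -(@dvdz_pexp2r _ _ 2) // E2 dvdz_mull.
have {E2} Ec2 : c ^+ 2 = n ^+ 2 - 4 * n.
  have b20 : b ^+ 2 != 0 by rewrite sqrf_eq0.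
  by apply: (mulIf b20); rewrite -E2 Ec exprMn.
rewrite -(real_normK (num_real c)) in Ec2; have d0 := normr_ge0 c.
move: `|c| d0 Ec2 => d d0; rewrite !expr2; have n4 := n_gt4.
by have [dn|dn] := lerP (n - 2) d; nia.
Qed.

Variables x t : K.
Hypotheses (x_plus_t : x + t = - n%:~R) (x_times_t : x * t = n%:~R).

Lemma root1_neq0 : x != 0.
Proof. by apply: contra (intr_neq0_of_gt4 K n_gt4) => /eqP x0; rewrite -x_times_t x0 mul0r. Qed.

Lemma root2_neq0 : t != 0.
Proof. by apply: contra (intr_neq0_of_gt4 K n_gt4) => /eqP t0; rewrite -x_times_t t0 mulr0. Qed.

Lemma eval_f : laurent_eval x t f = 0.
Proof.
rewrite !laurent_evalD laurent_evalM ?root1_neq0 ?root2_neq0 // !laurent_eval_mono /=.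
by rewrite !expr0z !expr1z !(mulr1, mul1r) x_times_t x_plus_t addNr.
Qed.

Lemma eval_g : laurent_eval x t g = 0.
Proof.
rewrite !laurent_evalD !laurent_eval_mono laurent_eval_int /=.
by rewrite !expr0z !expr1z !(mulr1, mul1r) -addrA x_plus_t addrN.
Qed.

(** Together with [ideal2_eval], this identifies the ideal with the kernel of evaluation. The
    remainder [a + b * y] of [n ^+ N * p] takes the value zero, which irrationality of [x] permits
    only for [a = b = 0]; then [n ^+ N] is cancelled. *)
Lemma eval_eq0_ideal2 p : laurent_eval x t p = 0 -> ideal2 f g p.
Proof.
move=> p0; have [N [a [b I]]] := reducible_all n p.
suff [a0 b0] : a = 0 /\ b = 0.
  by apply: (@ideal2_n_cancel n N); move: I; rewrite a0 b0 mul0r addr0 subr0.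
have := ideal2_eval root1_neq0 root2_neq0 eval_f eval_g I.
rewrite laurent_evalB !laurent_evalD !laurent_evalM ?root1_neq0 ?root2_neq0 //.
rewrite !laurent_eval_int laurent_eval_mono p0 mulr0 sub0r /= mulr1 expr1z.
move=> /eqP; rewrite oppr_eq0 => /eqP ab0.
have b0 : b = 0.
  apply: (@no_rational_root a b); apply/eqP; rewrite -(intr_eq0 K).
  (* The quadratic form is the norm of [a + b * x], that is, its product with its conjugate. *)
  apply/eqP; transitivity ((a%:~R + b%:~R * x) * (a%:~R + b%:~R * t) : K).
    transitivity (a%:~R ^+ 2 + a%:~R * b%:~R * (x + t) + b%:~R ^+ 2 * (x * t) : K).
      by rewrite x_plus_t x_times_t; ring.
    by ring.
  by rewrite ab0 mul0r.
by split=> //; move: ab0; rewrite b0 mul0r addr0 => /eqP; rewrite intr_eq0 => /eqP.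
Qed.

End Roots.

Lemma exprz_mul_eq1 (n : int) x t r : 4 < n -> x + t = - n%:~R -> x * t = n%:~R ->
  x != t -> x ^ r.1 * t ^ r.2 = 1 -> r = 0.
Proof.
move=> n_gt4 xDt xMt x_neq_t; case: r => a b /= E.
have tDx : t + x = - n%:~R by rewrite addrC.
have tMx : t * x = n%:~R by rewrite mulrC.
have x0 := root1_neq0 n_gt4 xMt; have t0 := root2_neq0 n_gt4 xMt.
have nK0 : 0 < n%:~R :> K by rewrite ltr0z; lia.
(* The ideal is symmetric in the two roots, so the relation can be conjugated. *)
have E' : t ^ a * x ^ b = 1.
  have I : ideal2 (mono (1, 0) + mono (0, 1) + mono (1, 0) * mono (0, 1))
      (n%:~R + mono (1, 0) + mono (0, 1)) (mono (a, b) - 1).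
    apply: (eval_eq0_ideal2 n_gt4 xDt xMt).
    by rewrite laurent_evalB laurent_eval_mono (laurent_eval_int _ _ 1) /= E subrr.
  have := ideal2_eval t0 x0 (eval_f n_gt4 tDx tMx) (eval_g tDx) I.
  rewrite laurent_evalB laurent_eval_mono (laurent_eval_int _ _ 1) /=.
  by move=> /eqP; rewrite subr_eq0 => /eqP.
have ab : a + b = 0.
  have : (n%:~R : K) ^ (a + b) == 1.
    rewrite -xMt expfzMl !expfzDr //.
    have -> : x ^ a * x ^ b * (t ^ a * t ^ b) = (x ^ a * t ^ b) * (t ^ a * x ^ b) by ring.
    by rewrite E E' mulr1.
  rewrite pexprz_eq1 ?(ltW nK0) // => /orP[/eqP //|].
  by rewrite (eqr_int K n 1) => /eqP n1; move: n_gt4; rewrite n1.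
have b_opp : b = - a by lia.
have : (x / t) ^ a == 1.
  by rewrite expfzMl exprz_inv -b_opp E.
rewrite pexprz_eq1 => [/orP[/eqP a0|]|]; first by rewrite b_opp a0 oppr0.
  by rewrite -(divff t0) (inj_eq (mulIf _)) ?invr_eq0 // (negPf x_neq_t).
(* Writing the ratio over a square shows it nonnegative, which excludes the value -1 with an even
   exponent. *)
have -> : x / t = n%:~R / t ^+ 2 by rewrite -xMt; field.
by rewrite divr_ge0 ?(ltW nK0) // sqr_ge0.
Qed.

(** The ideal is the kernel of a map into a field, hence prime, and [mono r - 1] lies outside it
    because no nontrivial monomial takes the value 1. *)
Lemma ideal2_colon (n : int) r p : 4 < n -> r != 0 ->
  let f := mono (1, 0) + mono (0, 1) + mono (1, 0) * mono (0, 1) in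
  let g := n%:~R + mono (1, 0) + mono (0, 1) in
  ideal2 f g ((mono r - 1) * p) -> ideal2 f g p.
Proof.
move=> n_gt4 r0 f g I.
have n4 : 4 < n%:~R :> K by move: n_gt4; rewrite -(ltr_int K) rmorph_nat.
set d := n%:~R ^+ 2 - 4 * n%:~R : K.
have d0 : 0 < d by rewrite /d; nra.
have sd : Num.sqrt d ^+ 2 = d by rewrite sqr_sqrtr // ltW.
have s0 : 0 < Num.sqrt d by rewrite sqrtr_gt0.
pose x := (- n%:~R + Num.sqrt d) / 2; pose t := (- n%:~R - Num.sqrt d) / 2.
have xDt : x + t = - n%:~R by rewrite /x /t; field.
have xMt : x * t = n%:~R.
  transitivity ((n%:~R ^+ 2 - Num.sqrt d ^+ 2) / 4); first by rewrite /x /t; field.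
  by rewrite sd /d; field.
have x_neq_t : x != t.
  by rewrite -subr_eq0 (_ : x - t = Num.sqrt d) ?gt_eqF // /x /t; field.
have x0 := root1_neq0 n_gt4 xMt; have t0 := root2_neq0 n_gt4 xMt.
apply: (eval_eq0_ideal2 n_gt4 xDt xMt).
have := ideal2_eval x0 t0 (eval_f n_gt4 xDt xMt) (eval_g xDt) I.
rewrite laurent_evalM // => /eqP; rewrite mulf_eq0 => /orP[|/eqP //].
rewrite laurent_evalB laurent_eval_mono (laurent_eval_int _ _ 1) subr_eq0 => /eqP.
by move=> /(exprz_mul_eq1 n_gt4 xDt xMt x_neq_t) /eqP; rewrite (negPf r0).
Qed.

End Evaluation.

(** * Excitations as pairs of ideal classes *)

(** The rows of [eps] involve disjoint entries of [l], so the components decouple; [bar] carries the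
    ideal of [bar f] and [bar g] in the first row to that of [f] and [g]. *)
Lemma trivial_excP (f g : laurent) (e : 'cV[laurent]_2) :
  trivial_exc f g e <-> ideal2 f g (bar (e 0 0)) /\ ideal2 f g (e 1 0).
Proof.
split=> [[l <-]|[[u [v E0]] [u' [v' E1]]]].
  rewrite epsE !mxE /=; split; last by exists (- l 1 0), (l 0 0); ring.
  exists (bar (l 2 0)), (bar (l 3 0)).
  by rewrite rmorphD !rmorphM /= !barK; ring.
exists (\col_i [:: v'; - u'; bar u; bar v]`_i).
apply/matrixP => i j; rewrite ord1 epsE !mxE /=.
case: i => [[|[|//]] Hi] /=.
  have -> : Ordinal Hi = 0 by apply: val_inj.
  by rewrite -[RHS]barK E0 rmorphD !rmorphM /=; ring.
have -> : Ordinal Hi = 1 by apply: val_inj.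
by rewrite E1; ring.
Qed.

Unset Implicit Arguments.

Theorem mainTheorem1 (K : realType) (n : int) (hn : 4 < n) :
  let y := mono (1, 0) in
  let z := mono (0, 1) in
  let f := y + z + y * z in
  let g := n%:~R + y + z in
  (forall (e : 'cV[laurent]_2),
     (exists r : int * int, r != (0, 0) /\ movable_yz f g r e) ->
     trivial_exc f g e) /\
  (forall e : 'cV[laurent]_2, movable_x f g K e).
Proof.
move=> y z f g; split.
  move=> e [r [r0 /trivial_excP[]]]; rewrite !mxE rmorphM rmorphB rmorph1 /=.
  (* On the first component the displacement becomes [- r], again nonzero. *)
  rewrite [bar (mono r)]bar_term -/(mono _).
  move=> I0 I1; apply/trivial_excP; split; last exact: (ideal2_colon K hn r0 I1).
  by apply: (ideal2_colon K hn _ I0); rewrite oppr_eq0.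
exact: movable_x_of_inverse (decays_ginv K hn) (conv_ginv K hn).
Qed.
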